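(* Let $q$ be a prime power and $m,\ell$ positive integers such that $\ell<\frac m2$ and $m_\ell=\frac{m}{(m,\ell)}$ is even, and put $n=\frac{q^m-1}{q^{(m,\ell)}+1}$. Then the complete weight enumerator of $\mathcal{C}_\ell$ is $$W_{\mathcal{C}_\ell}(z_0,\ldots,z_{q-1})=z_0^n+n\,z_0^{a_0}z_1^{a_1}\cdots z_{q-1}^{a_1}+nq^{(m,\ell)}z_0^{a_0'}z_1^{a_1'}\cdots z_{q-1}^{a_1'},$$ where $$a_0=n-\tfrac{(q-1)q^{m-1}}{q^{(m,\ell)}+1}\big(1+(-1)^{\frac12m_\ell}q^{(m,\ell)-\frac m2}\big),\qquad a_1=\tfrac{q^{m-1}}{q^{(m,\ell)}+1}\big(1+(-1)^{\frac12m_\ell}q^{(m,\ell)-\frac m2}\big),$$ $$a_0'=n-\tfrac{(q-1)q^{m-1}}{q^{(m,\ell)}+1}\big(1+(-1)^{\frac12m_\ell+1}q^{-\frac m2}\big),\qquad a_1'=\tfrac{q^{m-1}}{q^{(m,\ell)}+1}\big(1+(-1)^{\frac12m_\ell+1}q^{-\frac m2}\big).$$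
   Context: $(m,\ell)$ denotes the greatest common divisor. Let $\alpha$ be a generator of $\mathbb{F}_{q^m}^*$ and $\mathrm{Tr}_{q^m/q}$ the trace from $\mathbb{F}_{q^m}$ to $\mathbb{F}_q$. The code is $\mathcal{C}_\ell=\{(\mathrm{Tr}_{q^m/q}(\gamma\alpha^{(q^\ell+1)i}))_{i=0}^{n-1}:\gamma\in\mathbb{F}_{q^m}\}\subset\mathbb{F}_q^n$. Order the elements of $\mathbb{F}_q$ as $\omega_0=0,\omega_1,\ldots,\omega_{q-1}$. For $v\in\mathbb{F}_q^n$ let $t_i(v)$ be the number of coordinates of $v$ equal to $\omega_i$. The complete weight enumerator of a linear code $\mathcal{C}\subset\mathbb{F}_q^n$ is $W_{\mathcal{C}}(z_0,\ldots,z_{q-1})=\sum_{c\in\mathcal{C}}z_0^{t_0(c)}z_1^{t_1(c)}\cdots z_{q-1}^{t_{q-1}(c)}$. *)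

(* Defs.v *)
From HB Require Import structures.
From mathcomp Require Export all_boot all_order all_algebra.
From mathcomp Require Export all_fingroup all_solvable all_field.
From mathcomp Require Export mpoly.

Set Implicit Arguments.
Unset Strict Implicit.
Unset Printing Implicit Defensive.

Export GRing.Theory.
Open Scope ring_scope.

(* For an arbitrary finite extension L of the finite field F, the library alias
   [finvect_type L] is L itself, equipped with its [finFieldType] and
   [splittingFieldType] structures. *)

(* [galTrace] takes its values in the subfield 1 = F%:A of L; the coordinate on
   the basis (1) of that line brings them back to F, see [fieldTraceE]. *)
Definition fieldTrace (F : finFieldType) (L : fieldExtType F) (x : L) : F :=
  coord [tuple (1 : L)] ord0 (galTrace 1%AS {:finvect_type L} x).

Lemma fieldTraceE (F : finFieldType) (L : fieldExtType F) (x : L) :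
  (fieldTrace x)%:A = galTrace 1%AS {:finvect_type L} x.
Proof.
have gal : galois (1%AS : {subfield finvect_type L}) {:finvect_type L}.
  exact: finField_galois (sub1v _).
have /vlineP[a ha] := mem_galTrace gal (memvf (x : finvect_type L)).
rewrite /fieldTrace ha linearZ /=.
have free1 : free [tuple (1 : L)] by rewrite seq1_free oner_neq0.
by rewrite (coord_free ord0 ord0 free1) mulr1.
Qed.

Definition codeC (F : finFieldType) (L : fieldExtType F) (alpha : L)
    (l n : nat) : {set 'rV[F]_n} :=
  [set \row_(i < n) fieldTrace ((gamma : L) * alpha ^+ ((#|F| ^ l + 1) * i))
     | gamma : finvect_type L].
Arguments codeC {F} L alpha l n.

Definition coordCount (F : finFieldType) (n : nat) (v : 'rV[F]_n) (x : F) :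
    nat :=
  #|[set j : 'I_n | v ord0 j == x]|.

(* The sum ranges over the set of distinct codewords. *)
Definition completeWE (F : finFieldType) (q n : nat) (omega : 'I_q -> F)
    (C : {set 'rV[F]_n}) : {mpoly int[q]} :=
  \sum_(c in C) \prod_(i < q) 'X_i ^+ coordCount c (omega i).

(* The truncated division defining the length of the code is exact. *)
Lemma length_dvd (q m l : nat) :
  ~~ odd (m %/ gcdn m l) -> (q ^ gcdn m l + 1 %| q ^ m - 1)%N.
Proof.
set d := gcdn m l => /even_halfK he.
have hm : m = (d.*2 * (m %/ d)./2)%N.
  by rewrite -doubleMl doubleMr he mulnC divnK ?dvdn_gcdl.
rewrite hm expnM -[X in (_ - X)%N](exp1n (m %/ d)./2) subn_exp.
have -> : (q ^ d.*2 - 1 = (q ^ d - 1) * (q ^ d + 1))%N.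
  by rewrite -muln2 expnM -subn_sqr exp1n.
by apply: dvdn_mulr; apply: dvdn_mull.
Qed.

(* Main.v *)
Require Import Defs.
From mathcomp Require Import zify ring.

(** Write [d = gcd(m, l)], [N = q ^ d + 1] and, for [g] in the field [K] with [q ^ m]
    elements, [Q_g(x) = Tr(g * x ^ (q ^ l + 1))], a quadratic form on [K] over the
    field with [q] elements. As [m / d] is even, [gcd(q ^ l + 1, q ^ m - 1) = N]
    ([gcdn_expD1_expB1]), so that [alpha ^ (q ^ l + 1)] has order [n] and each of its
    powers is [x ^ (q ^ l + 1)] for exactly [N] units [x]. The composition of the word
    of [g] is thus that of the values of [Q_g] on [K - {0}], divided by [N]
    ([fiber_word]). Nonzero scalars are [q ^ l + 1]-th powers, so all nonzero values
    are taken equally often ([fiber_neq0]), and everything is governed by the single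
    integer [S(g)], the number of zeros of [Q_g] minus the number of times it takes
    the value [1] ([fiber_diff]).

    Counting the pairs [(x, y)] with [Q_g(x + y) = Q_g(y)] gives
    [S(g) ^ 2 = r * q ^ m], where [r] is the size of the radical of [Q_g]
    ([sum_fiber_sqr], [fiber_diff_sqr]); the form vanishes on its radical, which for
    [g != 0] is either zero or a line over the field with [q ^ (2 * d)] elements
    ([qform_radical], [card_radical]). So [S(g)] is [q ^ (m / 2)] or
    [q ^ (m / 2 + d)] up to sign. The sign comes for free: [S(g)] is [1] modulo [N],
    since each value is taken at a number of nonzero [x] divisible by [N], and [q ^ d]
    is [-1] modulo [N] ([fiber_diffE]). This leaves two possible values of [S(g)],
    hence two possible compositions.

    How often each occurs follows from a first moment: the [S(g)] with [g != 0] sum to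
    zero ([sum_fiber_diff]), which splits the [n * N] nonzero [g] into classes of
    sizes [n] and [n * q ^ d] ([card_fiber_diff]). Finally [l < m / 2] forces
    [S(g) < q ^ m] for [g != 0], so distinct [g] give distinct words ([word_inj]). *)

Set Implicit Arguments.
Unset Strict Implicit.
Unset Printing Implicit Defensive.

Import Num.Theory.

(** * Divisibility between [q ^ l + 1] and [q ^ m - 1] *)

(** When [m / d] is even, an inverse [a] of [l / d] modulo [m / d] has to be odd;
    so raising to the [a]-th power sends an equation with sign [-1] for [l] to an
    equation with sign [-1] for [d]. *)
Lemma odd_bezout_gcd (m l : nat) :
    (0 < l)%N -> ~~ odd (m %/ gcdn m l) ->
  exists a b : nat,
    [/\ odd a, odd (l %/ gcdn m l) & (a * l = gcdn m l + b * m)%N].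
Proof.
move=> l_gt0 even_e; have [a b def_d _] := egcdnP m l_gt0.
rewrite [gcdn l m]gcdnC in def_d; set d := gcdn m l in even_e def_d *.
exists a, b; rewrite addnC -def_d.
have d_gt0 : (0 < d)%N by rewrite gcdn_gt0 l_gt0 orbT.
have def_m : (m = m %/ d * d)%N by rewrite divnK ?dvdn_gcdl.
have def_l : (l = l %/ d * d)%N by rewrite divnK ?dvdn_gcdr.
have : (a * (l %/ d) = b * (m %/ d) + 1)%N.
  apply/eqP; rewrite -(eqn_pmul2r d_gt0) -mulnA -def_l mulnDl mul1n -mulnA -def_m.
  by rewrite def_d.
move/(congr1 odd); rewrite oddM oddD oddM (negPf even_e) andbF /= => /andP[].
by split.
Qed.

Lemma dvdn_expB1 (x k : nat) : (x - 1 %| x ^ k - 1)%N.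
Proof. by rewrite -[X in (_ ^ k - X)%N](exp1n k) subn_exp dvdn_mulr. Qed.

Lemma dvdn_expD1_odd (x k : nat) : (0 < x)%N -> odd k -> (x + 1 %| x ^ k + 1)%N.
Proof.
move=> x_gt0 odd_k; have -> : k = ((k./2).*2).+1 by rewrite odd_halfK // prednK ?odd_gt0.
set h := k./2.
have xh_gt0 : (0 < x ^ h.*2)%N by rewrite expn_gt0 x_gt0.
have -> : (x ^ h.*2.+1 + 1 = x * (x ^ h.*2 - 1) + (x + 1))%N.
  by rewrite expnS mulnBr muln1 addnA subnK // leq_pmulr.
rewrite dvdn_addl // dvdn_mull // -mul2n expnM.
apply: dvdn_trans (dvdn_expB1 _ _).
by rewrite -(exp1n 2) subn_sqr dvdn_mull.
Qed.

(** The divisors of [q ^ l + 1] see [q ^ l] as [-1]; those of [q ^ m - 1] see [q ^ m]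
    as [1], so a common divisor sees [q ^ d = q ^ (a * l - b * m)] as [(-1) ^ a = -1]. *)
Lemma gcdn_expD1_expB1 (q m l : nat) :
  (0 < q)%N -> (0 < l)%N -> ~~ odd (m %/ gcdn m l) ->
  gcdn (q ^ l + 1) (q ^ m - 1) = (q ^ gcdn m l + 1)%N.
Proof.
move=> q_gt0 l_gt0 even_e; set d := gcdn m l.
have [a [b [odd_a odd_ld def_d]]] := odd_bezout_gcd l_gt0 even_e.
apply/eqP; rewrite eqn_dvd dvdn_gcd length_dvd // andbT; apply/andP; split.
  set g := gcdn _ _.
  have g_pow : (g %| q ^ d * (q ^ (b * m) - 1) + (q ^ d + 1))%N.
    have -> : (q ^ d * (q ^ (b * m) - 1) + (q ^ d + 1) = (q ^ l) ^ a + 1)%N.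
      rewrite -expnM (mulnC l) def_d expnD mulnBr muln1 addnA subnK //.
      by rewrite leq_pmulr // expn_gt0 q_gt0.
    apply: dvdn_trans (dvdn_gcdl _ _) (dvdn_expD1_odd _ odd_a).
    by rewrite expn_gt0 q_gt0.
  rewrite -(dvdn_addr _ (_ : g %| q ^ d * (q ^ (b * m) - 1))%N) // dvdn_mull //.
  rewrite mulnC expnM; exact: dvdn_trans (dvdn_gcdr _ _) (dvdn_expB1 _ _).
rewrite -[l](divnK (dvdn_gcdr m l)) mulnC expnM.
by apply: dvdn_expD1_odd; rewrite ?expn_gt0 ?q_gt0.
Qed.

(** * Powers in cyclic groups and finite fields *)

Lemma big_cycle (R : Type) (idx : R) (op : Monoid.com_law idx)
    (gT : finGroupType) (a : gT) (G : gT -> R) :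
  \big[op/idx]_(x in <[a]>%g) G x = \big[op/idx]_(k < #[a]%g) G (a ^+ k)%g.
Proof.
rewrite (reindex_onto (fun k : 'I_(#[a]%g) => (a ^+ k)%g)
  (* The default of [odflt] is never reached on [<[a]>]. *)
  (fun x => odflt (Ordinal (order_gt0 a)) [pick k : 'I_(#[a]%g) | (a ^+ k == x)%g])) /=.
  apply: eq_bigl => k; rewrite mem_cycle /=.
  case: pickP => [j /=|/(_ k)]; last by rewrite eqxx.
  by rewrite eq_expg_mod_order !modn_small.
move=> x /cyclePmin[k lt_k ->]; case: pickP => [j /= /eqP //|/(_ (Ordinal lt_k))].
by rewrite /= eqxx.
Qed.

(** On a cyclic group of order [o], the exponents of the [s]-th powers of the
    generator repeat with period [o / gcd(s, o)]. *)
Lemma sum_expg_cycle (gT : finGroupType) (a : gT) (s : nat) (G : gT -> nat) :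
  (\sum_(x in <[a]>%g) G (x ^+ s)%g =
     gcdn s #[a]%g * \sum_(j < #[a]%g %/ gcdn s #[a]%g) G (a ^+ (s * j))%g)%N.
Proof.
set o := #[a]%g; set g := gcdn s o.
have g_gt0 : (0 < g)%N by rewrite gcdn_gt0 order_gt0 orbT.
transitivity (\sum_(0 <= k < o) G (a ^+ (s * k))%g)%N.
  by rewrite big_mkord big_cycle; apply: eq_bigr => k _; rewrite -expgM mulnC.
rewrite -{1}(divnK (dvdn_gcdr s o)) -/g mulnC big_nat_mul mulnC -iter_addn_0.
rewrite -[in RHS](big_mkord predT (fun j => G (a ^+ (s * j))%g)).
set n := (o %/ g)%N.
rewrite (eq_bigr (fun _ => \sum_(0 <= j < n) G (a ^+ (s * j))%g)%N).
  by rewrite big_const_nat subn0.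
move=> i _; rewrite -{1}[(i * n)%N]add0n big_addn mulSn addnK.
apply: eq_bigr => j _; congr G; apply/eqP; rewrite eq_expg_mod_order mulnDr.
rewrite (_ : (s * (i * n) = (s %/ g * i) * o)%N) ?modnMDl 1?addnC ?modnMDl //.
rewrite -[in RHS](divnK (dvdn_gcdr s o)) -/g -/n -[in LHS](divnK (dvdn_gcdl s o)) -/g.
ring.
Qed.

Lemma card_expg_eq1_cycle (gT : finGroupType) (a : gT) (s : nat) :
  #|[set x in <[a]>%g | (x ^+ s == 1)%g]| = gcdn s #[a]%g.
Proof.
set g := gcdn s _.
have g_gt0 : (0 < g)%N by rewrite gcdn_gt0 order_gt0 orbT.
have n_gt0 : (0 < #[a]%g %/ g)%N.
  by rewrite divn_gt0 // dvdn_leq ?order_gt0 // dvdn_gcdr.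
rewrite -sum1dep_card big_mkcondr.
apply: etrans (sum_expg_cycle a s (fun y => (y == 1)%g : nat)) _; rewrite -/g.
rewrite (bigD1 (Ordinal n_gt0)) //= muln0 expg0 eqxx big1 ?addn0 ?muln1 // => j.
rewrite -val_eqE /= => j_neq0; apply/eqP; rewrite eqb0 expgM.
rewrite -order_dvdn orderXgcd gcdnC -/g; apply: contra j_neq0 => /dvdn_leq.
by case: (posnP j) => [-> //|_ /(_ isT)]; rewrite leqNgt ltn_ord.
Qed.

Lemma big_finField (R : Type) (idx : R) (op : Monoid.com_law idx)
    (K : finFieldType) (G : K -> R) :
  \big[op/idx]_x G x = op (G 0) (\big[op/idx]_(u : {unit K}) G (FinRing.uval u)).
Proof.
rewrite (bigD1 0) //=; congr (op _ _).
rewrite (reindex_onto (fun u : {unit K} => FinRing.uval u) (fun x : K => insubd (1%g : {unit K}) x)) /=.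
  by apply: eq_bigl => u; rewrite valKd eqxx andbT -unitfE (valP u).
by move=> x x_neq0; rewrite insubdK // -topredE /= unitfE.
Qed.

Lemma card_expf_eq1 (K : finFieldType) (s : nat) :
  #|[set u : {unit K} | (u ^+ s == 1)%g]| = gcdn s #|K|.-1.
Proof.
have /cyclicP[a def_a] := field_unit_group_cyclic [set: {unit K}]%G.
rewrite -card_finField_unit def_a -orderE -card_expg_eq1_cycle -def_a.
by apply: eq_card => u; rewrite !inE.
Qed.

(** * The trace of a finite extension *)

Section Trace.

Variables (F : finFieldType) (L : fieldExtType F).
Local Notation K := (finvect_type L).
Local Notation q := #|F|.
Local Notation m := (\dim {:L}).

Lemma card_finvect : #|K| = (q ^ m)%N.
Proof. by rewrite -(card_vspacef (Vector.class K)) card_vspace. Qed.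

Lemma exprDn_card (k : nat) (x y : K) :
  (x + y) ^+ (q ^ k) = x ^+ (q ^ k) + y ^+ (q ^ k).
Proof.
have [p p_pr pF] := finPcharP F.
have [r q_pr] : exists r, q = (p ^ r)%N.
  have := card_pgroup (pprimeChar_pgroup pF); rewrite cardsT => ->; by eexists.
apply: exprDn_pchar; rewrite (eq_pnat _ (pcharf_eq (_ : p \in [pchar K]))).
  by rewrite q_pr !pnatX pnat_id ?orbT.
by rewrite pchar_lalg.
Qed.

Lemma expr_cardm (x : K) : x ^+ (q ^ m) = x.
Proof. by rewrite -card_finvect expf_card. Qed.

Lemma exprZ_card (k : nat) (c : F) (x : K) :
  (c *: x) ^+ (q ^ k) = c *: x ^+ (q ^ k).
Proof.
rewrite exprZn; congr (_ *: _).
by elim: k => [|k IH]; rewrite ?expr1 // expnSr exprM IH expf_card.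
Qed.

(** The Galois group of a finite extension of [F] is generated by the Frobenius
    map [x |-> x ^ q]. *)
Lemma fieldTrace_sum (x : K) :
  (fieldTrace (x : L))%:A = \sum_(i < m) x ^+ (q ^ i) :> K.
Proof.
have gal : galois (1%AS : {subfield K}) {:K} by exact: finField_galois (sub1v _).
have [g genG g_q] := finField_galois_generator (sub1v {:K}).
rewrite [LHS]fieldTraceE /galTrace (eqP (genG : _ == <[g]>%g)) big_cycle.
have -> : #[g]%g = m.
  by rewrite orderE -(eqP (genG : _ == <[g]>%g)) -(galois_dim gal) dimv1 divn1.
apply: eq_bigr => i _; elim: (i : nat) => [|k IH].
  by rewrite expg0 gal_id expn0 expr1.
by rewrite expgSr galM ?memvf // IH g_q ?memvf // dimv1 -exprM expnSr expn1.
Qed.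

(** The trace read on the finite-field copy of [L], over which sets and sums of
    field elements can be formed. *)
Definition tr (x : K) : F := fieldTrace (x : L).

Lemma trD (x y : K) : tr (x + y) = tr x + tr y.
Proof.
apply: (fmorph_inj (in_alg K)); rewrite rmorphD /= !fieldTrace_sum -big_split.
by apply: eq_bigr => i _; rewrite exprDn_card.
Qed.

Lemma trZ (c : F) (x : K) : tr (c *: x) = c * tr x.
Proof.
apply: (fmorph_inj (in_alg K)); rewrite rmorphM /= !fieldTrace_sum.
rewrite mulr_algl scaler_sumr; by apply: eq_bigr => i _; rewrite exprZ_card.
Qed.

Lemma trX (k : nat) (x : K) : tr (x ^+ (q ^ k)) = tr x.
Proof.
elim: k => [|k IH]; first by rewrite expn0 expr1.
rewrite expnSr exprM -[RHS]IH; move: (x ^+ _) => {IH} y.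
apply: (fmorph_inj (in_alg K)); rewrite /= !fieldTrace_sum.
have m_gt0 : (0 < m)%N by rewrite adim_gt0.
rewrite -(prednK m_gt0) [LHS]big_ord_recr [RHS]big_ord_recl /= addrC.
rewrite -exprM -expnS prednK // expr_cardm expn0 expr1; congr (_ + _).
by apply: eq_bigr => i _; rewrite -exprM -expnS.
Qed.

(** Independence of characters makes the trace a nonzero linear form. *)
Lemma tr_eq1 (a : K) : a != 0 -> exists y, tr (a * y) = 1.
Proof.
move=> a_neq0.
pose G := 'Gal({:K} / (1%AS : {subfield K}))%g.
have [y _ ty_neq0] := @gal_independent_contra F K {:K}%AS (fun g => g \in G)
  (fun=> 1) 1%g (group1 _) (oner_neq0 _).
have {ty_neq0} ty_neq0 : tr y != 0.
  apply: contra ty_neq0 => /eqP ty0; have := fieldTraceE (y : L).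
  rewrite -/(tr y) ty0 scale0r => tr0; rewrite [X in X == 0](_ : _ = 0) // [RHS]tr0.
  by apply: eq_bigr => g _; rewrite mul1r.
exists (a^-1 * ((tr y)^-1 *: y)).
by rewrite mulVKf // trZ mulVf.
Qed.

Lemma tr0 : tr 0 = 0.
Proof. by have /eqP := trD 0 0; rewrite addr0 -subr_eq0 opprD addNKr oppr_eq0 => /eqP. Qed.

(** The fibres of a nonzero linear form are translates of each other. *)
Lemma card_tr_fiber (a : K) (v : F) :
  a != 0 -> #|[set y | tr (a * y) == v]| = (q ^ (m - 1))%N.
Proof.
move=> a_neq0; have [e tr_e] := tr_eq1 a_neq0.
pose fib u := [set y | tr (a * y) == u].
have card_fib u : #|fib u| = #|fib v|.
  rewrite -(card_imset (mem (fib u)) (addrI ((v - u) *: e))).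
  apply: eq_card => y; rewrite !inE; apply/imsetP/eqP => [[z]|tr_y].
    by rewrite inE => /eqP tr_z ->; rewrite mulrDr -scalerAr trD trZ tr_e tr_z mulr1 subrK.
  exists (y - (v - u) *: e); last by rewrite addrC subrK.
  rewrite inE mulrDr mulrN -scalerAr -scaleNr trD trZ tr_e tr_y mulr1.
  by rewrite opprB addrC subrK.
have q_gt0 : (0 < q)%N by apply/card_gt0P; exists 0.
have m_gt0 : (0 < m)%N by rewrite adim_gt0.
apply/eqP; rewrite -(eqn_pmul2l q_gt0) -expnS subn1 prednK // -card_finvect.
rewrite -[X in _ == X]sum1_card (partition_big (fun y => tr (a * y)) predT) //=.
rewrite -sum_nat_const; apply/eqP/eq_bigr => u _.
by rewrite sum1dep_card -(card_fib u).
Qed.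

Lemma exprN_card (k : nat) (x : K) : (- x) ^+ (q ^ k) = - x ^+ (q ^ k).
Proof. by rewrite -scaleN1r exprZ_card scaleN1r. Qed.

Lemma expr_card_inj (k : nat) : injective (fun x : K => x ^+ (q ^ k)).
Proof.
move=> x y /= /eqP; rewrite -subr_eq0 -exprN_card -exprDn_card expf_eq0 subr_eq0.
by case/andP=> _ /eqP.
Qed.

Lemma expr_card_mul (c : F) (k j : nat) (x : K) :
  x ^+ (q ^ k) = c *: x -> x ^+ (q ^ (j * k)) = c ^+ j *: x.
Proof.
move=> xk; elim: j => [|j IH]; first by rewrite mul0n expn0 expr0 expr1 scale1r.
by rewrite mulSn expnD exprM xk exprZ_card IH scalerA -exprS.
Qed.

(** [x ^ (q ^ i)] only depends on [i] modulo [m], since [x ^ (q ^ m) = x]. *)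
Lemma expr_card_eigen (c : F) (k j i : nat) (x : K) :
    x ^+ (q ^ k) = c *: x -> (j * k = i %[mod m])%N ->
  x ^+ (q ^ i) = c ^+ j *: x.
Proof.
move=> xk eq_mod; rewrite -(expr_card_mul j xk).
have red s : x ^+ (q ^ s) = x ^+ (q ^ (s %% m)).
  rewrite {1}(divn_eq s m) expnD exprM -[X in _ = X ^+ _]scale1r.
  by rewrite (@expr_card_mul 1) ?expr1n // scale1r expr_cardm.
by rewrite red -eq_mod -red.
Qed.

(** The hypothesis forces [w ^ (q ^ d) = - w], so that the [m] conjugates of [w]
    split into [m / 2d] blocks of length [2d], in each of which the second half
    is the opposite of the first. The argument covers characteristic 2, where
    [2 * tr w = 0] would say nothing. *)
Lemma tr_anti (l : nat) (w : K) :
    (0 < l)%N -> ~~ odd (m %/ gcdn m l) ->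
  w ^+ (q ^ l) = - w -> tr w = 0.
Proof.
move=> l_gt0 even_e wl.
have [a [b [odd_a _ def_d]]] := odd_bezout_gcd l_gt0 even_e.
set d := gcdn m l in even_e def_d *.
have wd : w ^+ (q ^ d) = - w.
  rewrite (@expr_card_eigen (-1) l a) ?scaleN1r //; last by rewrite def_d addnC modnMDl.
  by rewrite -signr_odd odd_a scaleN1r.
apply: (fmorph_inj (in_alg K)); rewrite rmorph0 /= fieldTrace_sum.
rewrite -(big_mkord predT (fun i => w ^+ (q ^ i))).
have -> : m = ((m %/ d)./2 * (d + d))%N.
  by rewrite addnn -muln2 mulnCA mulnC muln2 even_halfK // divnK ?dvdn_gcdl.
rewrite big_nat_mul big1 // => j _.
rewrite mulSn addnC; set u := (j * _)%N.
rewrite (@big_cat_nat _ _ _ (u + d)) ?leq_addr ?leq_add2l ?leq_addr //=.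
rewrite [X in _ + X]big_addn addnA addnK -big_split big1 //= => i _.
by rewrite addnC expnD exprM wd exprN_card addrN.
Qed.

End Trace.

(** * The quadratic form [tr (g * x ^ (q ^ l + 1))] *)

Section QuadraticForm.

Variables (F : finFieldType) (L : fieldExtType F) (l : nat).
Local Notation K := (finvect_type L).
Local Notation q := #|F|.
Local Notation m := (\dim {:L}).
Local Notation d := (gcdn m l).
Hypotheses (l_gt0 : (0 < l)%N) (even_e : ~~ odd (m %/ d)).

Definition qform (g x : K) : F := tr (g * x ^+ (q ^ l + 1)).

(** The coefficient of [y ^ (q ^ l)] when the polar form
    [qform (x + y) - qform x - qform y] is written as a trace, see [qformD]. *)
Definition polar (g x : K) : K := g * x + g ^+ (q ^ l) * x ^+ (q ^ (2 * l)).

Definition radical (g : K) : {set K} := [set x | polar g x == 0].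

Lemma qform0 g : qform g 0 = 0.
Proof. by rewrite /qform addn1 expr0n mulr0 tr0. Qed.

Lemma qform0l x : qform 0 x = 0.
Proof. by rewrite /qform mul0r tr0. Qed.

(** The cross term [tr (g * x ^ (q ^ l) * y)] is brought to the shape
    [tr (_ * y ^ (q ^ l))] by applying Frobenius under the trace. *)
Lemma qformD g x y :
  qform g (x + y) = qform g x + tr (polar g x * y ^+ (q ^ l)) + qform g y.
Proof.
rewrite /qform /polar mulrDl trD.
have <- : tr (g * (x ^+ (q ^ l) * y)) =
          tr (g ^+ (q ^ l) * x ^+ (q ^ (2 * l)) * y ^+ (q ^ l)).
  by rewrite -[LHS](trX l) mulrA !exprMn -exprM -expnD addnn mul2n.
rewrite -!trD; congr tr; rewrite !exprD !expr1 exprDn_card.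
ring.
Qed.

(** On the radical, [w = g * x ^ (q ^ l + 1)] satisfies [w ^ (q ^ l) = - w]. *)
Lemma qform_radical g x : x \in radical g -> qform g x = 0.
Proof.
rewrite inE /polar addrC addr_eq0 => /eqP pol0; apply: (tr_anti l_gt0 even_e).
rewrite exprMn -exprM mulnDl mul1n exprD -expnD addnn -mul2n mulrA pol0.
by rewrite addn1 exprSr mulNr; congr (- _); ring.
Qed.

(** The fixed points form the subfield with [q ^ (2 * d)] elements, because
    [2 * d] is the gcd of [2 * l] and [m]. *)
Lemma card_fixed_Frobenius : #|[set t : K | t ^+ (q ^ (2 * l)) == t]| = (q ^ (2 * d))%N.
Proof.
have q_gt0 : (0 < q)%N by apply/card_gt0P; exists 0.
have m_gt0 : (0 < m)%N by rewrite adim_gt0.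
have [a [b [_ _ def_d]]] := odd_bezout_gcd l_gt0 even_e.
have -> : [set t : K | t ^+ (q ^ (2 * l)) == t] = [set t | t ^+ (q ^ (2 * d)) == t].
  apply/setP=> t; rewrite !inE; apply/eqP/eqP=> fix_t.
    rewrite (@expr_card_eigen _ _ 1 (2 * l) a) ?scale1r ?expr1n ?scale1r //.
    by rewrite mulnCA def_d mulnDr mulnCA addnC mulnA modnMDl.
  rewrite (@expr_card_eigen _ _ 1 (2 * d) (l %/ d)) ?scale1r ?expr1n ?scale1r //.
  by rewrite mulnCA divnK ?dvdn_gcdr.
rewrite -sum1dep_card big_mkcond big_finField /=.
rewrite expr0n expn_eq0 (gtn_eqF q_gt0) /= eqxx -big_mkcond sum1dep_card.
have pow_gt0 k : (0 < q ^ k)%N by rewrite expn_gt0 q_gt0.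
rewrite -[RHS](subnK (pow_gt0 (2 * d)%N)) addnC; congr (_ + _)%N.
have <- : gcdn (q ^ (2 * d) - 1) #|K|.-1 = (q ^ (2 * d) - 1)%N.
  apply/gcdn_idPl; rewrite card_finvect -subn1.
  have def_m : m = (2 * d * (m %/ d)./2)%N.
    by rewrite mulnAC mul2n even_halfK // divnK ?dvdn_gcdl.
  by rewrite [X in (_ %| q ^ X - 1)%N]def_m (expnM q (2 * d)) dvdn_expB1.
rewrite -card_expf_eq1; apply: eq_card => u; rewrite !inE.
rewrite -(inj_eq val_inj) FinRing.val_unitX /= -[X in _ == X](mulr1).
rewrite -{1}(subnK (pow_gt0 (2 * d)%N)) addn1 exprS (inj_eq (mulfI _)) //.
by rewrite -unitfE (valP u).
Qed.

(** A nonzero radical is a line over the fixed field of [t |-> t ^ (q ^ (2 * l))]. *)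
Lemma card_radical (g : K) : g != 0 ->
  #|radical g| = 1%N \/ #|radical g| = (q ^ (2 * d))%N.
Proof.
move=> g_neq0; have rad0 : 0 \in radical g.
  have q_gt0 : (0 < q)%N by apply/card_gt0P; exists 0.
  by rewrite inE /polar mulr0 expr0n expn_eq0 (gtn_eqF q_gt0) mulr0 addr0.
have [x /andP[x_rad x_neq0]|rad] := pickP (fun x => (x \in radical g) && (x != 0));
    last first.
  left; rewrite -(cards1 (0 : K)); apply: eq_card => x.
  rewrite [RHS]inE; have [-> //|x_neq0] := eqVneq x 0.
  by have := rad x; rewrite x_neq0 andbT.
right; rewrite -card_fixed_Frobenius -[RHS](card_imset _ (mulfI x_neq0)).
have pol t : polar g (x * t) = g * x * (t - t ^+ (q ^ (2 * l))).
  move: x_rad; rewrite inE /polar addrC addr_eq0 => /eqP pol0.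
  by rewrite /polar exprMn mulrA [X in _ + X]mulrA pol0; ring.
have gx_neq0 : g * x != 0 by rewrite mulf_neq0.
apply: eq_card => y; apply/idP/imsetP => [|[t]].
  rewrite -[y](mulVKf x_neq0) inE pol mulf_eq0 (negPf gx_neq0) subr_eq0 eq_sym.
  by exists (x^-1 * y); rewrite ?inE ?mulVKf.
by rewrite !inE => /eqP fix_t ->; rewrite pol fix_t subrr mulr0.
Qed.

Definition fiber (g : K) (v : F) : nat := #|[set x | qform g x == v]|.

Lemma sum_fiber (g : K) : (\sum_v fiber g v = q ^ m)%N.
Proof.
rewrite -card_finvect -sum1_card (partition_big (qform g) predT) //=.
by apply: eq_bigr => v _; rewrite sum1dep_card.
Qed.

(** The sum of squares counts the pairs [(x, y)] with [qform (x + y) = qform y].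
    For [x] fixed this is an affine condition on [y ^ (q ^ l)], which is
    vacuous when [x] lies in the radical and cuts out a hyperplane otherwise. *)
Lemma sum_fiber_sqr (g : K) : g != 0 ->
  (\sum_v fiber g v ^ 2 + #|radical g| * q ^ (m - 1)
     = q ^ m * q ^ (m - 1) + #|radical g| * q ^ m)%N.
Proof.
move=> g_neq0.
have -> : (\sum_v fiber g v ^ 2 = \sum_(x : K) #|[set y : K | qform g (x + y)%R == qform g y]|)%N.
  transitivity (\sum_(y : K) fiber g (qform g y))%N.
    rewrite [RHS](partition_big (qform g) predT) //=; apply: eq_bigr => v _.
    rewrite -mulnn -{1}[fiber g v]sum1dep_card big_distrl /=.
    by apply: eq_bigr => y /eqP ->; rewrite mul1n.
  transitivity (\sum_(y : K) \sum_(x : K | qform g (x + y)%R == qform g y) 1)%N.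
    apply: eq_bigr => y _; rewrite sum1dep_card.
    rewrite -(card_imset _ (addIr y)); apply: eq_card => z; rewrite inE.
    apply/idP/imsetP => [z_fib|[x]]; last by rewrite inE => x_fib ->.
    by exists (z - y); rewrite ?inE subrK.
  under eq_bigr do rewrite big_mkcond; rewrite exchange_big /=.
  by apply: eq_bigr => x _; rewrite -big_mkcond sum1dep_card.
have card_rad x : x \in radical g ->
    #|[set y | qform g (x + y) == qform g y]| = (q ^ m)%N.
  move=> x_rad; rewrite -card_finvect -cardsT; apply: eq_card => y; rewrite !inE.
  have := x_rad; rewrite inE => /eqP pol0.
  by rewrite qformD qform_radical // pol0 mul0r tr0 !add0r eqxx.
have card_nrad x : x \notin radical g ->
    #|[set y | qform g (x + y) == qform g y]| = (q ^ (m - 1))%N.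
  rewrite inE => pol_neq0; rewrite -(card_tr_fiber (- qform g x) pol_neq0).
  rewrite -[LHS](card_imset _ (@expr_card_inj F L l)); apply: eq_card => z.
  have /codomP[y ->] : z \in codom (fun x : K => x ^+ (q ^ l)).
    exact: (inj_card_onto (@expr_card_inj F L l)).
  rewrite (mem_imset _ _ (@expr_card_inj F L l)) !inE qformD.
  by rewrite -subr_eq0 addrK addrC addr_eq0.
rewrite (bigID (mem (radical g))) /= (eq_bigr _ card_rad).
rewrite (eq_bigr _ card_nrad) !sum_nat_const.
have <- : (#|radical g| + #|[predC radical g]| = q ^ m)%N by rewrite cardC card_finvect.
rewrite -addnA -mulnDl [(#|[predC _]| + _)%N]addnC addnC.
by congr (_ * _ + _)%N.
Qed.

(** For a fixed [x != 0] the condition [qform g x = 0] is linear in [g]. *)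
Lemma sum_fiber0 : (\sum_(g : K) fiber g 0%R = q ^ m + (q ^ m - 1) * q ^ (m - 1))%N.
Proof.
transitivity (\sum_(x : K) #|[set g | qform g x == 0%R]|)%N.
  transitivity (\sum_(g : K) \sum_(x | qform g x == 0%R) 1)%N.
    by apply: eq_bigr => g _; rewrite sum1dep_card.
  under eq_bigr do rewrite big_mkcond; rewrite exchange_big /=.
  by apply: eq_bigr => x _; rewrite -big_mkcond sum1dep_card.
rewrite (bigD1 (0 : K)) //=; congr (_ + _)%N.
  by rewrite -card_finvect -cardsT; apply: eq_card => g; rewrite !inE qform0 eqxx.
rewrite (eq_bigr (fun=> q ^ (m - 1)))%N => [|x x_neq0].
  by rewrite sum_nat_const; congr (_ * _)%N; rewrite -card_finvect subn1 -(cardC1 (0 : K)).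
have x'_neq0 : x ^+ (q ^ l + 1) != 0 by rewrite expf_neq0.
rewrite -(card_tr_fiber 0 x'_neq0); apply: eq_card => g.
by rewrite !inE /qform mulrC.
Qed.

End QuadraticForm.

(** * Zeros versus nonzero values of the form *)

Section FiberDifference.

Variables (F : finFieldType) (L : fieldExtType F) (l : nat).
Local Notation K := (finvect_type L).
Local Notation q := #|F|.
Local Notation m := (\dim {:L}).
Local Notation d := (gcdn m l).
Local Notation N := (q ^ d + 1)%N.
Local Notation n := ((q ^ m - 1) %/ N)%N.
Hypotheses (l_gt0 : (0 < l)%N) (even_e : ~~ odd (m %/ d)).

Let q_gt1 : (1 < q)%N. Proof. exact: finNzRing_gt1. Qed.
Let q_gt0 : (0 < q)%N. Proof. exact: ltnW. Qed.
Let m_gt0 : (0 < m)%N. Proof. by rewrite adim_gt0. Qed.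

Lemma length_mul : (n * N = q ^ m - 1)%N.
Proof. by rewrite divnK // length_dvd. Qed.

Lemma length_gt0 : (0 < n)%N.
Proof.
have : (1 < q ^ m)%N by rewrite -(expn0 q) ltn_exp2l.
by rewrite -subn_gt0 -{1}length_mul muln_gt0 => /andP[].
Qed.

Lemma order_generator (alpha : {unit K}) :
  generator [set: {unit K}] alpha -> #[alpha]%g = (q ^ m - 1)%N.
Proof.
move=> /eqP def_alpha; rewrite orderE -def_alpha card_finField_unit.
by rewrite card_finvect subn1.
Qed.

Lemma length_dvd_pred : (q - 1 %| n)%N.
Proof.
have def_m : m = (d * 2 * (m %/ d)./2)%N.
  by rewrite -mulnA mul2n even_halfK // mulnC divnK ?dvdn_gcdl.
have N_gt0 : (0 < N)%N by rewrite addn1.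
rewrite -(dvdn_pmul2r N_gt0) length_mul.
apply: (@dvdn_trans ((q ^ d - 1) * N)); first by rewrite dvdn_mul ?dvdn_expB1.
have -> : ((q ^ d - 1) * N = (q ^ d) ^ 2 - 1)%N by rewrite -subn_sqr exp1n.
by rewrite -expnM [X in (_ %| q ^ X - 1)%N]def_m (expnM q (d * 2)) dvdn_expB1.
Qed.

(** A scalar [c] satisfies [c ^ n = 1] because [q - 1] divides [n], and the [n]-th
    roots of unity of [K] are its [q ^ l + 1]-th powers. *)
Lemma scalar_power (c : F) : c != 0 -> exists t : K, t ^+ (q ^ l + 1) = c%:A.
Proof.
move=> c_neq0.
have cA_unit : (c%:A : K) \is a GRing.unit by rewrite unitfE scaler_eq0 negb_or c_neq0 oner_neq0.
pose u : {unit K} := FinRing.unit K cA_unit.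
have /cyclicP[a def_a] := field_unit_group_cyclic [set: {unit K}]%G.
have a_gen : generator [set: {unit K}] a by apply/eqP.
have /cyclePmin[k _ def_u] : u \in <[a]>%g by rewrite -def_a inE.
have n_gt0 := length_gt0.
have : (u ^+ n == 1)%g.
  rewrite -(inj_eq val_inj) FinRing.val_unitX /=.
  have /dvdnP[j ->] := length_dvd_pred.
  rewrite mulnC exprM exprZn expr1n.
  suff -> : c ^+ (q - 1) = 1 by rewrite scale1r expr1n.
  apply: (mulfI c_neq0); rewrite mulr1 -exprS -addn1 subnK //.
  exact: expf_card.
rewrite def_u -expgM -order_dvdn (order_generator a_gen) -{1}length_mul mulnC dvdn_pmul2r //.
case/dvdnP=> j def_k.
have ql_gt0 : (0 < q ^ l + 1)%N by rewrite addn1.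
have [i b def_N _] := egcdnP (q ^ m - 1) ql_gt0.
rewrite gcdn_expD1_expB1 // in def_N.
(* [u] is a power of [a ^ N], and [N] is congruent to [i * (q ^ l + 1)] modulo the
   order of [a]. *)
exists (FinRing.uval (a ^+ (i * j))%g).
rewrite -FinRing.val_unitX -expgM.
rewrite -[RHS]/(FinRing.uval u) def_u; congr (FinRing.uval _).
apply/eqP; rewrite eq_expg_mod_order (order_generator a_gen).
by rewrite mulnAC def_N mulnDl mulnAC modnMDl def_k mulnC.
Qed.

Lemma fiber_neq0 (g : K) (v : F) : v != 0 -> fiber l g v = fiber l g 1.
Proof.
move=> v_neq0; have [t tN] := scalar_power v_neq0.
have t_neq0 : t != 0.
  apply: contraNneq v_neq0 => t0; move: tN.
  by rewrite t0 addn1 expr0n => /esym/eqP; rewrite scaler_eq0 oner_eq0 orbF.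
rewrite /fiber -[RHS](card_imset _ (mulfI t_neq0)); apply: eq_card => x.
have qf y : qform l g (t * y) = v * qform l g y.
  rewrite /qform exprMn tN -trZ; congr tr.
  by rewrite mulr_algl scalerAr.
rewrite -[x](mulVKf t_neq0) (mem_imset _ _ (mulfI t_neq0)) !inE qf.
by rewrite -{2}[v]mulr1 (inj_eq (mulfI v_neq0)).
Qed.

Lemma fiber01 (g : K) : (fiber l g 0%R + (q - 1) * fiber l g 1%R = q ^ m)%N.
Proof.
rewrite -(sum_fiber l g) (bigD1 (0 : F)) //=; congr (_ + _)%N.
rewrite (eq_bigr (fun=> fiber l g 1)) => [|v]; last exact: fiber_neq0.
by rewrite sum_nat_const subn1 -(cardC1 (0 : F)).
Qed.

(** The value at [g] of the exponential sum attached to [qform g], for any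
    nontrivial additive character of [F]: the nonzero values are taken equally
    often, see [fiber_neq0], and the character values at them sum to [-1]. *)
Definition fiber_diff (g : K) : int := (fiber l g 0)%:Z - (fiber l g 1)%:Z.

Lemma fiber_diff_sqr (g : K) : g != 0 ->
  fiber_diff g ^+ 2 = (#|radical l g| * q ^ m)%:Z.
Proof.
move=> g_neq0; have := sum_fiber_sqr l_gt0 even_e g_neq0.
have := fiber01 g; rewrite (bigD1 (0 : F)) //=.
rewrite (eq_bigr (fun=> fiber l g 1%R ^ 2))%N => [|v v_neq0]; last by rewrite fiber_neq0.
rewrite sum_nat_const.
have -> : #|predC1 (0 : F)| = (q - 1)%N by rewrite cardC1 subn1.
rewrite /fiber_diff -(prednK m_gt0) expnS [(_.+1 - 1)%N]subn1 /=.
set M := (q ^ _)%N; set r := #|radical _ _|; set c0 := fiber _ _ _; set c1 := fiber _ _ _.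
rewrite -!mulnn; have := q_gt1; move: (q) => Q Q_gt1 sum1 sum2.
have Q1 : (Q - 1)%:Z = Q%:Z - 1 by lia.
have Q1_neq0 : Q%:Z - 1 != 0 by lia.
apply: (mulfI Q1_neq0).
have E1 : c0%:Z + (Q%:Z - 1) * c1%:Z = Q%:Z * M%:Z.
  by rewrite -Q1 -!PoszM -PoszD sum1.
have E2 : c0%:Z * c0%:Z + (Q%:Z - 1) * (c1%:Z * c1%:Z) + r%:Z * M%:Z
    = Q%:Z * M%:Z * M%:Z + r%:Z * (Q%:Z * M%:Z).
  by rewrite -Q1 -!PoszM -!PoszD sum2.
rewrite !PoszM.
have -> : (Q%:Z - 1) * (c0%:Z - c1%:Z) ^+ 2 =
  Q%:Z * (c0%:Z * c0%:Z + (Q%:Z - 1) * (c1%:Z * c1%:Z))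
   - (c0%:Z + (Q%:Z - 1) * c1%:Z) ^+ 2 by ring.
rewrite E1 -[X in Q%:Z * X](addrK (r%:Z * M%:Z)) E2; ring.
Qed.

(** The total of the differences over all [g] is [q ^ m], and [g = 0] contributes
    all of it. *)
Lemma sum_fiber_diff : \sum_(g : K | g != 0) fiber_diff g = 0.
Proof.
have q1_neq0 : q%:Z - 1 != 0 by have := q_gt1; lia.
apply: (mulfI q1_neq0); rewrite mulr0 big_distrr /=.
have E g : (q%:Z - 1) * fiber_diff g = q%:Z * (fiber l g 0)%:Z - (q ^ m)%:Z.
  rewrite /fiber_diff -(fiber01 g) PoszD PoszM.
  have -> : (q - 1)%:Z = q%:Z - 1 by have := q_gt1; lia.
  by move: (fiber _ _ 0)%:Z (fiber _ _ 1)%:Z => x y; ring.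
under eq_bigr do rewrite E.
rewrite big_split /= sumr_const -mulr_sumr -(rmorph_sum Posz).
have /eqP := sum_fiber0 L l; rewrite (bigD1 (0 : K)) //=.
have -> : fiber l (0 : K) 0 = (q ^ m)%N.
  by rewrite /fiber -card_finvect -cardsT; apply: eq_card => x; rewrite !inE qform0l eqxx.
rewrite eqn_add2l => /eqP ->.
rewrite (cardC1 (0 : K)) card_finvect -subn1 PoszM mulrCA -PoszM -expnS [(m - 1)%N]subn1.
by rewrite (prednK m_gt0) mulNrn -mulr_natl natz subrr.
Qed.

Lemma half_dim : (m = (m %/ 2) + m %/ 2)%N /\ (m %/ 2 = d * (m %/ d %/ 2))%N.
Proof.
have def_m : m = (d * (m %/ d %/ 2) * 2)%N.
  by rewrite -mulnA divn2 muln2 even_halfK // mulnC divnK ?dvdn_gcdl.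
have def_h : (m %/ 2 = d * (m %/ d %/ 2))%N by rewrite {1}def_m mulnK.
by rewrite def_h addnn -muln2.
Qed.

End FiberDifference.

(** * The words of the code *)

(** The square determines [S] up to sign; modulo [N] the two candidates [e * h] and
    [- (e * h)] are [1] and [-1], which differ as soon as [N > 2]. *)
Lemma sign_of_residue (N S h e k j : int) :
    2 < N -> e ^+ 2 = 1 -> S ^+ 2 = h ^+ 2 -> S = 1 + N * k -> h = e + N * j ->
  S = e * h.
Proof.
move=> N_gt2 e2 Sh defS defh; apply/eqP; rewrite -subr_eq0; apply/eqP.
have /eqP : (S - e * h) * (S + e * h) = 0 by rewrite -subr_sqr exprMn e2 Sh mul1r subrr.
rewrite mulf_eq0 => /orP[/eqP //|/eqP S_eh].
have : N * (k + e * j) = - 2 by move: S_eh e2; rewrite defS defh => ? ?; lia.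
move: (k + e * j) N_gt2 => x {}N_gt2 Nx.
have [x_ge0|x_lt0] : 0 <= x \/ x <= -1 by lia.
  by nia.
by nia.
Qed.

Lemma coordCount0 (F : finFieldType) (n : nat) (x : F) :
  coordCount (0 : 'rV[F]_n) x = if x == 0 then n else 0%N.
Proof.
case: eqVneq => [->|x_neq0].
  by rewrite -[RHS]card_ord -cardsT; apply: eq_card => i; rewrite !inE mxE eqxx.
apply/eqP; rewrite cards_eq0; apply/eqP/setP=> i.
by rewrite !inE mxE eq_sym (negPf x_neq0).
Qed.

Lemma prod_coordCount (F : finFieldType) (q n : nat) (omega : 'I_q -> F) (i0 : 'I_q)
    (v : 'rV[F]_n) (a0 a1 : nat) :
    injective omega -> omega i0 = 0 -> coordCount v 0 = a0 ->
    (forall x, x != 0 -> coordCount v x = a1) ->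
  \prod_(i < q) 'X_i ^+ coordCount v (omega i) =
    'X_i0 ^+ a0 * \prod_(i < q | i != i0) 'X_i ^+ a1 :> {mpoly int[q]}.
Proof.
move=> omega_inj omega0 v0 v1; rewrite (bigD1 i0) //= omega0 v0; congr (_ * _).
by apply: eq_bigr => i i_neq; rewrite v1 // -omega0 (inj_eq omega_inj).
Qed.

Section Code.

Variables (F : finFieldType) (L : fieldExtType F) (l : nat).
Local Notation K := (finvect_type L).
Local Notation q := #|F|.
Local Notation m := (\dim {:L}).
Local Notation d := (gcdn m l).
Local Notation N := (q ^ d + 1)%N.
Local Notation n := ((q ^ m - 1) %/ N)%N.
Hypotheses (l_gt0 : (0 < l)%N) (even_e : ~~ odd (m %/ d)).
Variable alpha : {unit K}.
Hypothesis alpha_gen : generator [set: {unit K}] alpha.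

Let q_gt1 : (1 < q)%N. Proof. exact: finNzRing_gt1. Qed.
Let q_gt0 : (0 < q)%N. Proof. exact: ltnW. Qed.
Let m_gt0 : (0 < m)%N. Proof. by rewrite adim_gt0. Qed.

Definition word (g : K) : 'rV[F]_n :=
  \row_(i < n) fieldTrace ((g : L) * (FinRing.uval alpha : L) ^+ ((q ^ l + 1) * i)).

(** The powers [x ^ (q ^ l + 1)] of the units run [N] times through the [n]
    elements [alpha ^ ((q ^ l + 1) * i)], by the gcd computation. *)
Lemma fiber_word (g : K) (v : F) :
  fiber l g v = ((v == 0%R) + N * coordCount (word g) v)%N.
Proof.
rewrite /fiber -sum1dep_card big_mkcond big_finField /=; congr (_ + _)%N.
  by rewrite qform0 eq_sym; case: eqP.
pose G (u : {unit K}) : nat := tr (g * FinRing.uval u) == v.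
transitivity (\sum_(u in <[alpha]>%g) G (u ^+ (q ^ l + 1))%g)%N.
  rewrite -(eqP (alpha_gen : _ == <[alpha]>%g)).
  by apply: eq_big => [u|u _]; rewrite ?inE // /G FinRing.val_unitX /qform; case: eqP.
rewrite sum_expg_cycle (order_generator alpha_gen) gcdn_expD1_expB1 //; congr (_ * _)%N.
rewrite /coordCount -sum1dep_card [RHS]big_mkcond /=; apply: eq_bigr => j _.
by rewrite mxE /G FinRing.val_unitX; case: eqP.
Qed.

Local Notation e := ((-1) ^+ (m %/ d %/ 2) : int).
Local Notation h := ((q ^ (m %/ 2))%:Z : int).

(** The square of the difference is known up to the size of the radical, and
    [fiber_word] shows that the difference is [1] modulo [N]; as [q ^ d] is [-1]
    modulo [N], this fixes the sign in either case. *)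
Lemma fiber_diffE (g : K) : g != 0 ->
  fiber_diff l g = - (e * h * (q ^ d)%:Z) \/ fiber_diff l g = e * h.
Proof.
move=> g_neq0; have [def_m def_h] := half_dim even_e.
have sqr := fiber_diff_sqr l_gt0 even_e g_neq0.
have d_gt0 : (0 < d)%N by rewrite gcdn_gt0 m_gt0.
have N_gt2 : 2 < N%:Z.
  by have := ltn_expl d q_gt1; have : (q ^ 1 <= q ^ d)%N; [rewrite leq_exp2l | rewrite expn1; lia].
have e2 : e ^+ 2 = 1 by rewrite sqrr_sign.
have defS : fiber_diff l g = 1 + N%:Z * ((coordCount (word g) 0)%:Z - (coordCount (word g) 1)%:Z).
  by rewrite /fiber_diff !fiber_word eqxx oner_eq0 add0n [X in X - _]PoszD !PoszM mulrBr addrA.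
have [j defh] : exists j, h = e + N%:Z * j.
  (* The cofactor of [x - y] in [x ^ k - y ^ k], at [x = q ^ d] and [y = -1]. *)
  exists (\sum_(i < m %/ d %/ 2)
     ((q ^ d)%:Z ^+ ((m %/ d %/ 2).-1 - i) * (-1) ^+ i)).
  have -> : N%:Z = (q ^ d)%:Z - (-1) by rewrite PoszD; lia.
  by rewrite -subrXX def_h expnM -!rmorphXn /= addrC subrK.
have [r1|rq] := card_radical l_gt0 even_e g_neq0.
  right; apply: (sign_of_residue N_gt2 e2 _ defS defh).
  by rewrite sqr r1 mul1n {1}def_m expnD PoszM expr2.
left; rewrite -mulrA -mulNr.
have e2' : (- e) ^+ 2 = 1 by rewrite sqrrN.
apply: (sign_of_residue (j := h - j) N_gt2 e2' _ defS).
  by rewrite sqr rq {2}def_m mul2n -addnn !expnD !PoszM; ring.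
have -> : (q ^ d)%:Z = N%:Z - 1 by rewrite PoszD addrK.
by rewrite mulrBr mulr1 {2}defh; ring.
Qed.

Lemma coordCount_neq0 (g : K) (v : F) :
  v != 0 -> coordCount (word g) v = coordCount (word g) 1.
Proof.
move=> v_neq0; have := fiber_neq0 l_gt0 even_e g v_neq0; rewrite !fiber_word oner_eq0 (negPf v_neq0).
by rewrite !add0n => /eqP; rewrite eqn_pmul2l ?addn1 // => /eqP.
Qed.

Lemma sum_coordCount (g : K) :
  (coordCount (word g) 0%R + (q - 1) * coordCount (word g) 1%R = n)%N.
Proof.
have N_gt0 : (0 < N)%N by rewrite addn1.
have := fiber01 l_gt0 even_e g; rewrite !fiber_word oner_eq0 eqxx add0n.
move: (coordCount _ 0) (coordCount _ 1) => c0 c1 sum_f.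
apply/eqP; rewrite -(eqn_pmul2r N_gt0) (length_mul even_e) -sum_f -addnA (addKn 1).
by apply/eqP; rewrite mulnDl mulnC -mulnA [(c1 * _)%N]mulnC.
Qed.

Lemma coordCount_diff (g : K) :
  q%:Z * N%:Z * (coordCount (word g) 1)%:Z = h * h - fiber_diff l g.
Proof.
have [def_m _] := half_dim even_e; have := fiber01 l_gt0 even_e g.
have : fiber l g 1 = (N * coordCount (word g) 1%R)%N by rewrite fiber_word oner_eq0.
rewrite -mulrA -PoszM => <-; rewrite /fiber_diff {1}def_m expnD => /(congr1 Posz).
rewrite PoszD !PoszM => <-.
have -> : (q - 1)%:Z = q%:Z - 1 by have := q_gt1; lia.
ring.
Qed.

Lemma eq_coordCount (g g' : K) (v : F) :
  fiber_diff l g = fiber_diff l g' -> coordCount (word g) v = coordCount (word g') v.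
Proof.
move=> eq_diff.
have eq1 : coordCount (word g) 1 = coordCount (word g') 1.
  have := coordCount_diff g; rewrite eq_diff -coordCount_diff => /eqP.
  by rewrite -!PoszM eqz_nat eqn_pmul2l ?muln_gt0 ?q_gt0 ?addn1 // => /eqP.
have [->|v_neq0] := eqVneq v 0; last by rewrite !(coordCount_neq0 _ v_neq0).
have := etrans (sum_coordCount g) (esym (sum_coordCount g')).
by rewrite eq1 => /addIn.
Qed.

(** The two cardinals [A] and [B] add up to [n * N]; since [fiber_diffE] gives the
    differences on both classes, [sum_fiber_diff] reads [B = A * q ^ d]. *)
Lemma card_fiber_diff :
  #|[set g : K | (g != 0) && (fiber_diff l g == - (e * h * (q ^ d)%:Z))]| = n /\
  #|[set g : K | (g != 0) && (fiber_diff l g != - (e * h * (q ^ d)%:Z))]| = (n * q ^ d)%N.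
Proof.
set A := [set g | _]; set B := [set g | _].
have cardAB : (#|A| + #|B| = n * N)%N.
  rewrite (length_mul even_e) -card_finvect subn1 -(cardC1 (0 : K)).
  rewrite -[RHS](cardID (fun g : K => fiber_diff l g == - (e * h * (q ^ d)%:Z))).
  by congr (_ + _)%N; apply: eq_card => g; rewrite !inE // andbC.
have := sum_fiber_diff l_gt0 even_e.
rewrite (bigID (fun g => fiber_diff l g == - (e * h * (q ^ d)%:Z))) /=.
rewrite (eq_bigr (fun=> - (e * h * (q ^ d)%:Z))) => [|g /andP[_ /eqP //]].
rewrite [X in _ + X](eq_bigr (fun=> e * h)) => [|g /andP[g_neq0 /negPf A'g]]; last first.
  by have [/eqP|//] := fiber_diffE g_neq0; rewrite A'g.
rewrite !sumr_const -[X in _ *+ X + _]cardsE -[X in _ + _ *+ X]cardsE -/A -/B.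
have eh_neq0 : e * h != 0.
  by rewrite mulf_neq0 ?signr_eq0 // eqz_nat expn_eq0 (gtn_eqF q_gt0).
move=> sum0; have cardB : #|B| = (#|A| * q ^ d)%N.
  apply/eqP; rewrite -eqz_nat PoszM -subr_eq0.
  move: sum0 eh_neq0; move: (e * h) (q ^ d)%:Z #|A| #|B| => x y a b.
  rewrite -[_ *+ a]mulr_natl -[x *+ b]mulr_natl !natz => sum0 x_neq0.
  suff /eqP : x * (b%:Z - a%:Z * y) = 0 by rewrite mulf_eq0 (negPf x_neq0).
  by rewrite -[RHS]sum0; ring.
move: cardAB; rewrite cardB -{1}[#|A|]muln1 -mulnDr addnC => /eqP.
by rewrite eqn_pmul2r ?addn1 // => /eqP ->.
Qed.

Lemma wordB (g g' : K) : word (g - g') = word g - word g'.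
Proof.
apply/rowP=> i; rewrite !mxE -[LHS]/(tr _) mulrBl trD.
by congr (_ + _); rewrite -scaleN1r trZ mulN1r.
Qed.

(** A nonzero [g] with zero word would have difference [q ^ m], whereas its absolute
    value is at most [q ^ (m / 2 + d)] and [d <= l < m / 2]. *)
Lemma word_eq0 (g : K) : (2 * l < m)%N -> word g = 0 -> g = 0.
Proof.
move=> l_lt wg0; apply/eqP; apply: contraT => g_neq0.
have c1 : coordCount (word g) 1 = 0%N.
  rewrite /coordCount wg0; apply/eqP; rewrite cards_eq0; apply/eqP/setP => i.
  by rewrite !inE mxE eq_sym oner_eq0.
have [def_m def_h] := half_dim even_e.
have d_lt : (d < m %/ 2)%N.
  have : (d <= l)%N by rewrite dvdn_leq ?dvdn_gcdr.
  by move: def_m l_lt; move: (m %/ 2)%N d => x y; lia.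
have := coordCount_diff g; rewrite c1 mulr0 => /esym/eqP; rewrite subr_eq0.
have lt_qd : (q ^ d < q ^ (m %/ 2))%N by rewrite ltn_exp2l.
have qd_gt0 : (0 < q ^ d)%N by rewrite expn_gt0 q_gt0.
have [->|->] := fiber_diffE g_neq0; rewrite -signr_odd; case: odd; rewrite ?expr0 ?expr1.
- nia.
- nia.
- nia.
nia.
Qed.

Lemma word_inj : (2 * l < m)%N -> injective word.
Proof.
move=> l_lt g g' /eqP; rewrite -subr_eq0 -wordB => /eqP/(word_eq0 l_lt)/eqP.
by rewrite subr_eq0 => /eqP.
Qed.

(** All [g != 0] with the same [fiber_diff] contribute the same monomial, and the
    exponents can be read off at representatives [gA] and [gB] of the two classes. *)
Lemma completeWE_code (omega : 'I_q -> F) (i0 : 'I_q) :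
    (2 * l < m)%N -> injective omega -> omega i0 = 0 ->
  exists gA gB : K,
    [/\ fiber_diff l gA = - (e * h * (q ^ d)%:Z), fiber_diff l gB = e * h
      & completeWE omega (codeC L (FinRing.uval alpha) l n) =
          'X_i0 ^+ n
          + n%:R * ('X_i0 ^+ coordCount (word gA) 0
              * \prod_(i < q | i != i0) 'X_i ^+ coordCount (word gA) 1)
          + (n * q ^ d)%:R * ('X_i0 ^+ coordCount (word gB) 0
              * \prod_(i < q | i != i0) 'X_i ^+ coordCount (word gB) 1)].
Proof.
move=> l_lt omega_inj omega_0; have [cardA cardB] := card_fiber_diff.
set x : int := - _ in cardA cardB *.
have n_gt0 : (0 < n)%N := length_gt0 even_e.
have diffA (g : K) : (g != 0) && (fiber_diff l g == x) -> fiber_diff l g = x.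
  by case/andP=> _ /eqP.
have diffB (g : K) : (g != 0) && (fiber_diff l g != x) -> fiber_diff l g = e * h.
  case/andP=> g_neq0 /negPf g_nA.
  by have [/eqP|//] := fiber_diffE g_neq0; rewrite g_nA.
have [gA gA_in] : exists g : K, (g != 0) && (fiber_diff l g == x).
  by move: n_gt0; rewrite -cardA => /card_gt0P[g]; rewrite inE; exists g.
have [gB gB_in] : exists g : K, (g != 0) && (fiber_diff l g != x).
  have : (0 < n * q ^ d)%N by rewrite muln_gt0 n_gt0 expn_gt0 q_gt0.
  by rewrite -cardB => /card_gt0P[g]; rewrite inE; exists g.
exists gA, gB; split; [exact: diffA | exact: diffB |].
have termE (g g' : K) : fiber_diff l g = fiber_diff l g' ->
    \prod_(i < q) 'X_i ^+ coordCount (word g) (omega i) =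
      'X_i0 ^+ coordCount (word g') 0 *
        \prod_(i < q | i != i0) 'X_i ^+ coordCount (word g') 1 :> {mpoly int[q]}.
  move=> eq_diff; apply: prod_coordCount => // [|y y_neq0].
    exact: eq_coordCount.
  by rewrite (eq_coordCount _ eq_diff) coordCount_neq0.
rewrite /completeWE.
have -> : codeC L (FinRing.uval alpha) l n = [set word g | g : K] by [].
rewrite big_imset /=; last by move=> g g' _ _; exact: word_inj.
rewrite (bigD1 0) //= -addrA; congr (_ + _).
  have -> : word 0 = 0 by have := wordB 0 0; rewrite !subrr.
  rewrite (@prod_coordCount _ _ _ _ i0 _ n 0) // ?coordCount0 ?eqxx //.
    by rewrite big1 ?mulr1 // => i _; rewrite expr0.
  by move=> y /negPf y_neq0; rewrite coordCount0 y_neq0.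
rewrite (bigID (fun g => fiber_diff l g == x)) /=; congr (_ + _).
  rewrite (eq_bigr _ (fun g g_in =>
    termE g gA (etrans (diffA g g_in) (esym (diffA gA gA_in))))).
  by rewrite sumr_const -cardsE cardA mulr_natl.
rewrite (eq_bigr _ (fun g g_in =>
  termE g gB (etrans (diffB g g_in) (esym (diffB gB gB_in))))).
by rewrite sumr_const -cardsE cardB mulr_natl.
Qed.

End Code.

(** * The complete weight enumerator *)

(** As [q ^ m] is the square of [q ^ (m / 2)], dividing the hypothesis on [a1] by
    [q * (q ^ d + 1)] gives the closed form. *)
Lemma counts_rational (q m d n a0 a1 : nat) (s : int) :
    (0 < q)%N -> (0 < m)%N -> (m = m %/ 2 + m %/ 2)%N ->
    q%:Z * (q ^ d + 1)%:Z * a1%:Z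
      = (q ^ (m %/ 2))%:Z * (q ^ (m %/ 2))%:Z - (q ^ (m %/ 2))%:Z * s ->
    (a0 + (q - 1) * a1 = n)%N ->
  let Q : rat := q%:R in
  let a := Q ^+ (m - 1) / (Q ^+ d + 1) * (1 - s%:~R / Q ^+ (m %/ 2)) in
  a1%:R = a /\ a0%:R = n%:R - (Q - 1) * a.
Proof.
move=> q_gt0 m_gt0 def_m eq_a1 eq_n Q a.
have Q_neq0 : Q != 0 by rewrite pnatr_eq0 -lt0n.
have Qd1 : Q ^+ d + 1 != 0 by rewrite -natrX natr1 pnatr_eq0.
have a1E : a1%:R = a.
  have H_neq0 : Q ^+ (m %/ 2) != 0 by rewrite expf_neq0.
  have eq_m : Q ^+ (m - 1) = Q ^+ (m %/ 2) * Q ^+ (m %/ 2) / Q.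
    by rewrite -exprD -def_m -{2}(prednK m_gt0) exprSr mulfK // subn1.
  have /(congr1 (fun z : int => z%:~R : rat)) := eq_a1.
  rewrite rmorphB !rmorphM /= -!pmulrn natrD !natrX -/Q => eq_a1Q.
  rewrite /a eq_m.
  apply: (mulfI (mulf_neq0 Q_neq0 Qd1)); rewrite eq_a1Q.
  by field; rewrite Qd1 H_neq0 Q_neq0.
split=> //; rewrite -a1E -eq_n natrD natrM natrB //; ring.
Qed.

Theorem corollary4p2 (F : finFieldType) (L : fieldExtType F)
    (q m l n : nat) (alpha : {unit finvect_type L})
    (omega : 'I_q -> F) (i0 : 'I_q)
    (card_F : #|F| = q) (dim_L : \dim {:L} = m)
    (m_gt0 : (0 < m)%N) (l_gt0 : (0 < l)%N) (l_lt : (2 * l < m)%N)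
    (even_ml : ~~ odd (m %/ gcdn m l))
    (def_n : n = ((q ^ m - 1) %/ (q ^ gcdn m l + 1))%N)
    (alpha_gen : generator [set: {unit finvect_type L}] alpha)
    (omega_bij : bijective omega)
    (i0_0 : nat_of_ord i0 = 0%N) (omega_0 : omega i0 = 0) :
  let d := gcdn m l in
  let ml := (m %/ d)%N in
  let Q : rat := q%:R in
  exists a0 a1 a0' a1' : nat,
    [/\ a0%:R = n%:R - (Q - 1) * Q ^+ (m - 1) / (Q ^+ d + 1)
                 * (1 + (-1) ^+ (ml %/ 2) * Q ^ (d%:Z - (m %/ 2)%:Z)),
        a1%:R = Q ^+ (m - 1) / (Q ^+ d + 1)
                 * (1 + (-1) ^+ (ml %/ 2) * Q ^ (d%:Z - (m %/ 2)%:Z)),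
        a0'%:R = n%:R - (Q - 1) * Q ^+ (m - 1) / (Q ^+ d + 1)
                 * (1 + (-1) ^+ (ml %/ 2 + 1) * Q ^ (- (m %/ 2)%:Z)),
        a1'%:R = Q ^+ (m - 1) / (Q ^+ d + 1)
                 * (1 + (-1) ^+ (ml %/ 2 + 1) * Q ^ (- (m %/ 2)%:Z))
      & completeWE omega (codeC L (FinRing.uval alpha) l n) =
          'X_i0 ^+ n
          + n%:R * ('X_i0 ^+ a0 * \prod_(i < q | i != i0) 'X_i ^+ a1)
          + (n * q ^ d)%:R
            * ('X_i0 ^+ a0' * \prod_(i < q | i != i0) 'X_i ^+ a1')].
Proof.
subst q m n; move=> d ml Q.
have q_gt0 : (0 < #|F|)%N by apply/card_gt0P; exists 0.
have Q_neq0 : Q != 0 by rewrite pnatr_eq0 -lt0n.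
have [def_m _] := half_dim even_ml.
have [gA [gB [diffA diffB defWE]]] :=
  completeWE_code l_gt0 even_ml alpha_gen l_lt (bij_inj omega_bij) omega_0.
have sumc g := sum_coordCount l_gt0 even_ml alpha_gen g.
(* In both classes the difference is a multiple [s * q ^ (m / 2)], which is the shape
   that [counts_rational] expects. *)
have eqA := coordCount_diff l_gt0 even_ml alpha_gen gA.
rewrite diffA -mulrN [(-1) ^+ _ * _]mulrC -[_ * - _]mulrA in eqA.
have [a1E a0E] := counts_rational q_gt0 m_gt0 def_m eqA (sumc gA).
have eqB := coordCount_diff l_gt0 even_ml alpha_gen gB.
rewrite diffB [(-1) ^+ _ * _]mulrC in eqB.
have [a1E' a0E'] := counts_rational q_gt0 m_gt0 def_m eqB (sumc gB).
have signE : ((-1) ^+ (ml %/ 2) : int)%:~R = (-1) ^+ (ml %/ 2) :> rat.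
  by rewrite rmorphXn rmorphN1.
have facA : 1 + (-1) ^+ (ml %/ 2) * Q ^ (d%:Z - (\dim {:L} %/ 2)%:Z) =
    1 - ((-1) ^+ (ml %/ 2) * - (#|F| ^ d)%:Z : int)%:~R / Q ^+ (\dim {:L} %/ 2).
  rewrite rmorphM rmorphN /= signE -pmulrn natrX -/Q expfzDr // -exprnP -exprnN.
  by rewrite mulrN mulNr opprK mulrA.
have facB : 1 + (-1) ^+ (ml %/ 2 + 1) * Q ^ (- (\dim {:L} %/ 2)%:Z) =
    1 - ((-1) ^+ (ml %/ 2) : int)%:~R / Q ^+ (\dim {:L} %/ 2).
  by rewrite signE addn1 exprS mulN1r mulNr -exprnN.
exists (coordCount (word l alpha gA) 0), (coordCount (word l alpha gA) 1).
exists (coordCount (word l alpha gB) 0), (coordCount (word l alpha gB) 1).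
by rewrite facA facB -![(Q - 1) * _ / _]mulrA -![(Q - 1) * _ * _]mulrA.
Qed.
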